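(* Let $A\geq a\geq 1$ and $r\geq 2$ be integers. For $n\geq0$ let $\sigma\widetilde{mes}_{r,A,a}(n)=\sum_{\pi\in\overline{\mathcal{P}}(n)}\widetilde{mes}_{r,A,a}(\pi)$. Then \[ \sum_{n=0}^\infty\sigma\widetilde{mes}_{r,A,a}(n)q^{n} =\frac{(-q;q)_{\infty }}{(q;q)_{\infty }}\bigg[a+A\sum_{k=1}^{\infty }\frac{q^{A\binom{k}{2}+ka}}{(-q^{a};q^{A})_{k}}(-q^{(r-2)a};q^{(r-2)A})_{k}\bigg]. \]
   Context: An overpartition is a partition (finite non-increasing sequence of positive integers) in which the first occurrence of each part value may be overlined; $\overline{\mathcal{P}}(n)$ is the set of overpartitions of $n$. $(a;q)_\infty=\prod_{i\geq0}(1-aq^i)$, $(a;q)_n=\prod_{i=0}^{n-1}(1-aq^i)$ (so when $r=2$, $(-q^{0};q^{0})_k=2^k$); $|q|<1$. For $r\geq2$, $\widetilde{mes}_{r,A,a}(\pi)$ is the smallest positive integer $m\equiv a\pmod A$ such that $\pi$ has no overlined part $\overline{m}$ and $\pi$ has fewer than $r-1$ non-overlined parts equal to $m$. *)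

(* Defs.v *)
From mathcomp Require Export all_boot all_order all_algebra.
From mathcomp Require Export complex.
From mathcomp Require Export boolp classical_sets functions cardinality.
From mathcomp Require Export fsbigop reals topology normedtype sequences.

Set Implicit Arguments.
Unset Strict Implicit.
Unset Printing Implicit Defensive.

Import Order.TTheory GRing.Theory Num.Theory.
Import numFieldNormedType.Exports.

Local Open Scope classical_set_scope.

(* The sequence of parts; (m, true) is an overlined part, (m, false) a
   non-overlined part of size m. *)
Definition opart := seq (nat * bool).

Record is_overpartition (n : nat) (p : opart) : Prop := IsOverpartition {
  opart_pos : forall m, m \in unzip1 p -> 0 < m;
  opart_noninc : sorted geq (unzip1 p);
  opart_sum : sumn (unzip1 p) = n;
  (* only the first occurrence of a part size may be overlined *)
  opart_first : forall i, i < size p -> (nth (0, false) p i).2 ->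
    index (nth (0, false) p i).1 (unzip1 p) = i }.

Definition overpartitions (n : nat) : set opart := [set p | is_overpartition n p].

Definition mes_pred (r A a : nat) (p : opart) (m : nat) : bool :=
  [&& 0 < m, m == a %[mod A], (m, true) \notin p
    & count_mem (m, false) p < r - 1].

(* The value 0 is only used when no m satisfies mes_pred; see mes_exists. *)
Definition mes (r A a : nat) (p : opart) : nat :=
  if pselect (exists m, mes_pred r A a p m) is left h then ex_minn h else 0.

(* A finitely supported sum; overpartitions n is finite, see
   finite_overpartitions. *)
Definition sigma_mes (r A a n : nat) : nat :=
  \big[addn/0]_(p \in overpartitions n) mes r A a p.

Lemma mes_exists r A a (p : opart) : 0 < A -> 1 < r ->
  exists m, mes_pred r A a p m.
Proof.
move=> A0 r1.
pose m := a + (sumn (unzip1 p)).+1 * A.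
have mP b : (m, b) \notin p.
  apply/negP => /(map_f fst) /= mp.
  have : m <= sumn (unzip1 p).
    by move: mp; rewrite -/(unzip1 p) => /perm_to_rem/perm_sumn ->; rewrite leq_addr.
  apply/negP; rewrite -ltnNge /m.
  exact: leq_trans (leq_pmulr _ A0) (leq_addl _ _).
exists m; apply/and4P; split; last by rewrite (count_memPn (mP false)) subn_gt0.
- by rewrite /m addn_gt0 muln_gt0 A0 orbT.
- by rewrite /m addnC modnMDl.
- exact: mP.
Qed.

Lemma finite_overpartitions n : finite_set (overpartitions n).
Proof.
pose f (t : n.-bseq ('I_n.+1 * bool)) : opart :=
  [seq (nat_of_ord x.1, x.2) | x <- t].
apply: (@sub_finite_set _ _ (f @` setT)); last exact: finite_image.
move=> p [pos _ sump _].
have le_n m : m \in unzip1 p -> m <= n.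
  by move=> /perm_to_rem/perm_sumn; rewrite sump => ->; rewrite leq_addr.
have szp : size p <= n.
  rewrite -sump -(size_map fst p) -/(unzip1 p).
  elim: (unzip1 p) pos => //= x s IH pos.
  rewrite -add1n leq_add ?pos ?mem_head // IH // => m ms.
  by rewrite pos // inE ms orbT.
pose s := [seq (inord x.1 : 'I_n.+1, x.2) | x <- p].
have ss : size s <= n by rewrite size_map.
exists (Bseq ss) => //; rewrite /f /= /s -map_comp -[RHS]map_id.
apply/eq_in_map => -[m b] mp /=; rewrite inordK // ltnS le_n //.
exact: (map_f fst mp).
Qed.

Local Open Scope ring_scope.

Definition qpoch (K : pzRingType) (x q : K) (n : nat) : K :=
  \prod_(0 <= i < n) (1 - x * q ^+ i).

Definition cvg_qpoch_inf (K : numFieldType) (x q : K) : Prop :=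
  cvgn (qpoch x q).

Definition qpoch_inf (K : numFieldType) (x q : K) : K := limn (qpoch x q).

Definition cvg_sum (K : numFieldType) (m : nat) (u : nat -> K) : Prop :=
  cvgn (fun N => \sum_(m <= k < N) u k).

Definition infsum (K : numFieldType) (m : nat) (u : nat -> K) : K :=
  limn (fun N => \sum_(m <= k < N) u k).

(* Main.v *)
Require Import Defs.
From mathcomp Require Import finmap exp ring lra.

(* For a part size m, write x = q^m. The choices of multiplicities of m (a bit
   for the overlined copy and a number of plain copies) contribute
   (1 + x) / (1 - x), and those in which m is "present", i.e. overlined or
   occurring at least r - 1 times, contribute x (1 + x^(r-2)) / (1 - x).
   Since mes = a + A #{k >= 1 | a, a + A, ..., a + (k-1) A are all present},
   the generating function is the product of the first factors times
   a + A sum_k prod_(t < k) x_t (1 + x_t^(r-2)) / (1 + x_t), x_t = q^(a + t A).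
   Analytically, restrict to parts <= N A with at most L plain copies of each
   part. The sum is then finite and factors; letting L tend to infinity gives
   exactly the N-th truncation of the right-hand side. At |q| these truncations
   are bounded, so the series converges absolutely, and its tail at |q|
   dominates the distance between the N-th truncation at q and the partial sum
   of the series. *)

Import Order.TTheory GRing.Theory Num.Theory.
Import numFieldNormedType.Exports.

Set Implicit Arguments.
Unset Strict Implicit.
Unset Printing Implicit Defensive.

(** * Overpartitions as multiplicity functions *)

(** One relation covers both conditions on consecutive parts: it is irreflexive at overlined parts
    and reflexive at plain ones, so a sorted list repeats only plain parts and an overlined part
    heads its block. *)
Definition opart_gt (x y : nat * bool) : bool :=
  (y.1 < x.1) || (x.1 == y.1) && ~~ y.2.

Lemma opart_gt_trans : transitive opart_gt.
Proof.
move=> [y b] [x c] [z d]; rewrite /opart_gt /=.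
case/orP=> [xy|/andP[/eqP-> _]] /orP[yz|/andP[/eqP yz d0]].
- by rewrite (ltn_trans yz xy).
- by rewrite -yz xy.
- by rewrite yz.
- by rewrite yz eqxx d0 orbT.
Qed.

Lemma opart_gt_anti : antisymmetric opart_gt.
Proof.
move=> [x b] [y c]; rewrite /opart_gt /=.
by case: ltngtP => //= -> /andP[] /negPf -> /negPf ->.
Qed.

(** The first-occurrence condition is local: since sizes are non-increasing, an overlined part
    violates it exactly when the part just before it has the same size. *)
Lemma is_overpartitionP n p : is_overpartition n p <->
  [/\ 0 \notin unzip1 p, sorted opart_gt p & sumn (unzip1 p) = n].
Proof.
split=> [[pos /sortedP-/(_ 0) ni sm fst]|[p0 srt sm]].
  split=> //; first by apply/negP => /pos.
  apply/(sortedP (0, false)) => i ip.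
  have := ni i; rewrite size_map => /(_ ip).
  have ip' : i < size p by exact: ltnW.
  rewrite (nth_map (0, false)) // (nth_map (0, false)) //.
  rewrite /geq /= /opart_gt leq_eqVlt => /orP[/eqP e|->//].
  rewrite e eqxx ltnn /=; apply/negP => /(fst _ ip) /=.
  rewrite e => idx.
  have : index (nth (0, false) p i).1 (unzip1 p) <= i.
    rewrite -(nth_map _ 0) // leqNgt.
    by apply/negP => /(before_find 0) /=; rewrite eqxx.
  by rewrite idx ltnn.
have pw : {in gtn (size p) &,
    {homo nth (0, false) p : i j / i < j >-> opart_gt i j}}.
  by apply/pairwiseP; rewrite -(sorted_pairwise opart_gt_trans).
split=> //.
- by move=> m mp; rewrite lt0n; apply: contraNneq p0 => <-.
- rewrite sorted_map; apply: sub_sorted srt => x y /=.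
  by case/orP=> [/ltnW//|/andP[/eqP-> _]]; rewrite /geq /=.
- move=> i ip ov.
  have le_i : index (nth (0, false) p i).1 (unzip1 p) <= i.
    rewrite -(nth_map _ 0) // leqNgt.
    by apply/negP => /(before_find 0) /=; rewrite eqxx.
  apply/eqP; rewrite eqn_leq le_i /= leqNgt; apply/negP => lt_i.
  have : (nth (0, false) p i).1 \in unzip1 p by rewrite map_f // mem_nth.
  move/(nth_index 0); rewrite (nth_map (0, false)) ?(ltn_trans lt_i) // => e.
  have /orP[] := pw _ _ (ltn_trans lt_i ip) ip lt_i; last by rewrite ov andbF.
  by rewrite e ltnn.
Qed.

Lemma sorted_opart_gt_count_overlined m p :
  sorted opart_gt p -> count_mem (m, true) p = ((m, true) \in p).
Proof.
elim: p => //= x p IH xp; rewrite IH ?(path_sorted xp) // inE eq_sym.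
case: eqVneq => //= e; rewrite -e in xp; case: (boolP (_ \in p)) => // mp.
have /allP/(_ _ mp) := order_path_min opart_gt_trans xp.
by rewrite /opart_gt /= ltnn andbF.
Qed.

(** [w i] describes the size [i.+1], a shift that rules out parts equal to [0]. Sizes descend and
    the overlined copy comes first, so the list is sorted by [opart_gt]. *)
Fixpoint opart_of (w : nat -> bool * nat) (M : nat) : opart :=
  if M is M'.+1 then
    nseq (w M').1 (M, true) ++ nseq (w M').2 (M, false) ++ opart_of w M'
  else [::].

Lemma count_opart_of w M m b : count_mem (m.+1, b) (opart_of w M) =
  (m < M) * (if b then (w m).1 : nat else (w m).2).
Proof.
elim: M => //= M IH; rewrite !count_cat !count_nseq {}IH /= !xpair_eqE eqSS.
rewrite [m < M.+1]ltnS [m <= M]leq_eqVlt eq_sym.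
by case: eqVneq => [->|_]; case: b; rewrite /= ?ltnn ?mul1n ?mul0n ?addn0.
Qed.

Lemma sumn_opart_of w M : sumn (unzip1 (opart_of w M)) =
  \sum_(i < M) i.+1 * ((w i).1 + (w i).2).
Proof.
elim: M => [|M IH]; first by rewrite big_ord0.
rewrite big_ord_recr -IH /unzip1 /= !map_cat !sumn_cat !map_nseq !sumn_nseq.
by rewrite addnA [LHS]addnC mulnDr.
Qed.

Lemma opart_of_bounded w M x : x \in opart_of w M -> 0 < x.1 <= M.
Proof.
elim: M => //= M IH; rewrite !mem_cat !mem_nseq.
case/or3P=> [/andP[_ /eqP->]|/andP[_ /eqP->]|/IH/andP[-> /leqW]] //=.
Qed.

Lemma sorted_opart_of w M : sorted opart_gt (opart_of w M).
Proof.
rewrite (sorted_pairwise opart_gt_trans); elim: M => //= M IH.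
have lt_block m (b : bool) : allrel opart_gt (nseq m (M.+1, b)) (opart_of w M).
  apply/allrelP => x y /nseqP[-> _] /opart_of_bounded/andP[_ yM].
  by rewrite /opart_gt /= ltnS yM.
rewrite !pairwise_cat IH allrel_catr !lt_block /= !andbT; apply/and3P; split.
- by apply/allrelP => x y /nseqP[-> _] /nseqP[-> _]; rewrite /opart_gt /= eqxx orbT.
- by case: (w M).1.
- by elim: (w M).2 => //= k ->; rewrite all_nseq /opart_gt /= eqxx ltnn !orbT.
Qed.

Lemma overpartition_opart_of (w : nat -> bool * nat) M :
  is_overpartition (\sum_(i < M) i.+1 * ((w i).1 + (w i).2)) (opart_of w M).
Proof.
apply/is_overpartitionP; split; rewrite ?sorted_opart_of ?sumn_opart_of //.
by apply/mapP => -[x /opart_of_bounded/[swap] <-].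
Qed.

(** Both lists are sorted for a transitive antisymmetric relation, so they agree once all
    multiplicities do; [n <= M] leaves no part above [M]. *)
Lemma opart_ofK n p M : is_overpartition n p -> n <= M ->
  opart_of (fun i => ((i.+1, true) \in p, count_mem (i.+1, false) p)) M = p.
Proof.
case/is_overpartitionP => p0 srt sm nM.
apply: (sorted_eq opart_gt_trans opart_gt_anti) => //.
  exact: sorted_opart_of.
apply/allP => -[[|m] b] _ /=; apply/eqP.
  have zp x : x.1 = 0 -> 0 \notin unzip1 x.2 -> count_mem (x.1, b) x.2 = 0.
    by move=> -> x0; apply/count_memPn; apply: contra x0 => /(map_f fst).
  rewrite (zp (0, p)) // (zp (0, opart_of _ M)) //=.
  by apply/mapP => -[x /opart_of_bounded/[swap] <-].
rewrite count_opart_of; case: (ltnP m M) => mM.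
  by rewrite mul1n; case: b => //; rewrite sorted_opart_gt_count_overlined.
rewrite mul0n; apply/esym/count_memPn; apply: contraL mM => /(map_f fst) /= mp.
rewrite -ltnNge; apply: leq_trans nM; rewrite -sm.
by move/perm_to_rem/perm_sumn: mp => ->; rewrite leq_addr.
Qed.

(** * Minimal excludants as counts of present parts *)

Definition part_present (r : nat) (p : opart) (m : nat) : bool :=
  ((m, true) \in p) || (r - 1 <= count_mem (m, false) p).

Lemma sum_leq_nat j K : j <= K -> \sum_(1 <= k < K.+1) (k <= j : nat) = j.
Proof.
move=> jK; rewrite (big_cat_nat (n := j.+1)) //=.
rewrite (eq_big_nat _ _ (F2 := fun=> 1)) => [|k /andP[_]]; last first.
  by rewrite ltnS => ->.
rewrite sum_nat_const_nat muln1 subn1 /= big_nat big1 ?addn0 // => k.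
by case/andP=> jk _; rewrite leqNgt jk.
Qed.

(** With [mes] equal to [a + j * A], the [k]-th summand is [1] exactly for [k <= j]. Since parts are
    at most [K * A], the size [a + K * A] is absent, so [j <= K] and the finite sum misses
    nothing. *)
Lemma mes_eq r A a K p : 0 < a -> a <= A -> 1 < r ->
    {in unzip1 p, forall m, m <= K * A} ->
  mes r A a p = a + A *
    \sum_(1 <= k < K.+1) (all (fun t => part_present r p (a + t * A)) (iota 0 k)).
Proof.
move=> a0 aA r1 pK; have A0 := leq_trans a0 aA.
have predE m : mes_pred r A a p m =
    [&& 0 < m, m == a %[mod A] & ~~ part_present r p m].
  by rewrite /mes_pred /part_present negb_or -ltnNge.
rewrite /mes; case: pselect => [h|]; last by case; exact: mes_exists.
case: ex_minnP => m; rewrite predE => /and3P[m0 ma mN] min.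
have predE' t : mes_pred r A a p (a + t * A) = ~~ part_present r p (a + t * A).
  by rewrite predE addn_gt0 a0 addnC modnMDl eqxx.
(* As [1 <= a <= A], [a] is the least positive number in its class; the case [a = A] is separate
   because [a] then reduces to [0]. *)
have am : a <= m.
  rewrite leqNgt; apply/negP => ma'; move: ma.
  rewrite (modn_small (leq_trans ma' aA)).
  move: aA; rewrite leq_eqVlt => /orP[/eqP <-|/modn_small ->].
    by rewrite modnn; move: m0; case: (m).
  by rewrite (ltn_eqF ma').
have [j mj] : exists j, m = a + j * A.
  move: ma; rewrite eqn_mod_dvd // => /dvdnP[j e]; exists j.
  by rewrite -e subnKC.
have jK : j <= K.
  suff /min : mes_pred r A a p (a + K * A).
    by rewrite mj leq_add2l leq_pmul2r.
  rewrite predE' /part_present negb_or -ltnNge.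
  have N b : (a + K * A, b) \notin p.
    apply/negP => /(map_f fst)/pK /=.
    by rewrite leqNgt -{1}[K * A]add0n ltn_add2r a0.
  by rewrite N (count_memPn (N false)) subn_gt0.
rewrite mj mulnC; congr (_ + _ * _); rewrite -[LHS](sum_leq_nat jK).
(* One direction is the minimality of [m]; the other holds because [m] itself is not present. *)
apply: eq_big_nat => k _; congr (nat_of_bool _); apply/idP/allP => [kj t|h'].
  rewrite mem_iota add0n => /= tk; rewrite -[part_present _ _ _]negbK -predE'.
  apply/negP => /min; rewrite mj leq_add2l leq_pmul2r // leqNgt.
  by rewrite (leq_trans tk kj).
rewrite leqNgt; apply/negP => jk; move: mN.
by rewrite mj h' // mem_iota.
Qed.

Lemma leq_sum_uniq_subset (T : eqType) (s t : seq T) (F : T -> nat) :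
  uniq s -> {subset s <= t} -> \sum_(x <- s) F x <= \sum_(x <- t) F x.
Proof.
elim: s t => [|x s IH] t /=; first by rewrite big_nil.
case/andP=> xs us st; have xt : x \in t by rewrite st ?mem_head.
rewrite (perm_big _ (perm_to_rem xt)) !big_cons leq_add2l; apply: IH => // y ys.
have yx : y != x by apply: contraNneq xs => <-.
have := st y; rewrite inE ys orbT => /(_ isT).
by rewrite (perm_mem (perm_to_rem xt)) inE (negPf yx).
Qed.

(** * Overpartitions with bounded parts and multiplicities *)

Section TruncatedOverpartitions.
Variables M L : nat.
Implicit Type f : {ffun 'I_M -> bool * 'I_L.+1}.

(** A finite function type lets the sum over all assignments factor over sizes. The default
    [(false, 0)] belongs to indices from [M] on, which [opart_of] never reads. *)
Definition opart_ffun f : opart :=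
  opart_of (fun i => if insub i is Some j then ((f j).1, val (f j).2)
                     else (false, 0)) M.

Definition weight f : nat := \sum_(i < M) i.+1 * ((f i).1 + (f i).2).

Lemma overpartition_opart_ffun f : is_overpartition (weight f) (opart_ffun f).
Proof.
rewrite /weight /opart_ffun; set w := (X in opart_of X).
rewrite (eq_bigr (fun i : 'I_M => i.+1 * ((w i).1 + (w i).2))).
  exact: overpartition_opart_of.
by move=> i _; rewrite /w valK.
Qed.

Lemma count_opart_ffun f (i : 'I_M) b : count_mem (i.+1, b) (opart_ffun f) =
  if b then (f i).1 : nat else (f i).2.
Proof. by rewrite count_opart_of ltn_ord mul1n valK. Qed.

Lemma opart_ffun_inj : injective opart_ffun.
Proof.
move=> f g fg; apply/ffunP => i.
have e b := congr1 (count_mem (i.+1, b)) fg.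
move: (e true) (e false); rewrite !count_opart_ffun.
case: (f i) (g i) => [b c] [b' c'] /= bb /val_inj ->; congr (_, _).
by case: b b' bb => -[].
Qed.

Lemma opart_ffun_surj n p : is_overpartition n p -> n <= M -> n <= L ->
  exists f, opart_ffun f = p.
Proof.
move=> pn nM nL.
exists [ffun i : 'I_M => ((i.+1, true) \in p, inord (count_mem (i.+1, false) p))].
rewrite -[RHS](opart_ofK pn nM) /opart_ffun.
(* Positive parts summing to [n] number at most [n], so every multiplicity fits and [inord] is
   faithful. *)
have cL m : count_mem (m, false) p <= L.
  apply: leq_trans (count_size _ _) (leq_trans _ nL); case: pn => pos _ <- _.
  rewrite -(size_map fst p) -/(unzip1 p).
  elim: (unzip1 p) pos => //= x s IH pos.
  rewrite -add1n leq_add ?pos ?mem_head // IH // => m' ms.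
  by rewrite pos // inE ms orbT.
have ext w w' k : (forall i, i < k -> w i = w' i) -> opart_of w k = opart_of w' k.
  by elim: k => //= k IH h; rewrite h // IH // => i /ltnW; exact: h.
apply: ext => i iM; rewrite insubT ffunE /=.
by rewrite inordK // ltnS cL.
Qed.

Variables r A a : nat.

Let truncated (n : nat) := [seq opart_ffun f | f <- enum predT & weight f == n].

Let sum_truncated n : \sum_(f | weight f == n) mes r A a (opart_ffun f) =
  \sum_(p <- truncated n) mes r A a p.
Proof. by rewrite big_map big_filter enumT. Qed.

Let uniq_truncated n : uniq (truncated n).
Proof.
by rewrite (map_inj_uniq opart_ffun_inj) filter_uniq // enum_uniq.
Qed.

Let truncated_sub n : {subset truncated n <= fset_set (overpartitions n)}.
Proof.
move=> p /mapP[f]; rewrite mem_filter => /andP[/eqP <- _] ->.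
rewrite in_fset_set; last exact: finite_overpartitions.
exact/mem_set/overpartition_opart_ffun.
Qed.

(** The encoding is injective, so the left side is a sum over distinct overpartitions of [n]. *)
Lemma sum_mes_truncated_le n :
  \sum_(f | weight f == n) mes r A a (opart_ffun f) <= sigma_mes r A a n.
Proof.
rewrite sum_truncated /sigma_mes fsbig_finite; last exact: finite_overpartitions.
by apply: leq_sum_uniq_subset.
Qed.

Lemma sum_mes_truncated n : n <= M -> n <= L ->
  \sum_(f | weight f == n) mes r A a (opart_ffun f) = sigma_mes r A a n.
Proof.
move=> nM nL; apply/eqP; rewrite eqn_leq sum_mes_truncated_le /=.
rewrite sum_truncated /sigma_mes fsbig_finite; last exact: finite_overpartitions.
apply: leq_sum_uniq_subset => // p.
rewrite in_fset_set; last exact: finite_overpartitions.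
move/set_mem => pn; have [f fp] := opart_ffun_surj pn nM nL.
apply/mapP; exists f => //; rewrite mem_filter mem_enum andbT.
have := overpartition_opart_ffun f; rewrite fp => pf.
by rewrite -(opart_sum pn) -(opart_sum pf).
Qed.

End TruncatedOverpartitions.

Local Open Scope classical_set_scope.
Local Open Scope complex_scope.
Local Open Scope ring_scope.

(** * Truncated generating functions *)

Lemma prodr_bool (S : comNzRingType) (I : finType) (b : pred I) :
  \prod_i (b i)%:R = [forall i, b i]%:R :> S.
Proof.
case: (boolP [forall i, b i]) => [/forallP h|].
  by rewrite big1 // => i _; rewrite h.
rewrite negb_forall => /existsP[i /negPf bi].
by rewrite (bigD1 i) //= bi mul0r.
Qed.

Section LocalFactors.
Variables (r : nat) (S : comNzRingType).

(** The contribution of one part size with at most [L] plain copies, [x] being [q] to that size; [D]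
    tells whether the size is required to be present. *)
Definition local_factor (L : nat) (D : bool) (x : S) : S :=
  \sum_(j : bool * 'I_L.+1)
    (D ==> (j.1 || (r - 1 <= j.2)%N))%:R * x ^+ (j.1 + j.2).

(** Presence of several sizes is a conjunction of conditions on single sizes and the weight is
    additive, so the sum distributes into a product. The bound by [M] gives each required size its
    own factor. *)
Lemma truncated_genfun (A a k M L : nat) (q : S) :
    (0 < a)%N -> {in iota 0 k, forall t, (a + t * A <= M)%N} ->
  \sum_(f : {ffun 'I_M -> bool * 'I_L.+1})
    (all (fun t => part_present r (opart_ffun f) (a + t * A)) (iota 0 k))%:R
      * q ^+ weight f
  = \prod_(i < M)
      local_factor L (i.+1 \in [seq (a + t * A)%N | t <- iota 0 k]) (q ^+ i.+1).
Proof.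
move=> a0 kM; rewrite bigA_distr_bigA; apply: eq_bigr => f _ /=.
rewrite big_split /= prodr_bool; congr (_%:R * _); last first.
  by rewrite -prodrXr; apply: eq_bigr => i _; rewrite exprM.
congr (nat_of_bool _).
have presE (i : 'I_M) : part_present r (opart_ffun f) i.+1 =
    (f i).1 || (r - 1 <= (f i).2)%N.
  rewrite /part_present -has_pred1 has_count !count_opart_ffun.
  by case: (f i).1.
apply/allP/forallP => [h i|h t tk].
  by apply/implyP => /mapP[t /h pr it]; rewrite -presE it.
have tM := kM _ tk; have ta : (a + t * A).-1.+1 = (a + t * A)%N.
  by rewrite prednK // addn_gt0 a0.
rewrite -ta in tM; have := h (Ordinal tM); rewrite -presE /= ta => /implyP; apply.
by apply/mapP; exists t.
Qed.

End LocalFactors.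

(** * Limits as the bound on multiplicities grows *)

Section LocalLimits.
Variables (K : numFieldType).

Lemma cvg_prod_seq (I : Type) (s : seq I) (u : I -> nat -> K) (l : I -> K) :
    (forall i, u i n @[n --> \oo] --> l i) ->
  \prod_(i <- s) u i n @[n --> \oo] --> \prod_(i <- s) l i.
Proof.
move=> ul; elim: s => [|i s IH].
  by under eq_fun do rewrite big_nil; rewrite big_nil; exact: cvg_cst.
by under eq_fun do rewrite big_cons; rewrite big_cons; apply: cvgM.
Qed.

Lemma cvg_sum_seq (I : eqType) (s : seq I) (u : I -> nat -> K) (l : I -> K) :
    {in s, forall i, u i n @[n --> \oo] --> l i} ->
  \sum_(i <- s) u i n @[n --> \oo] --> \sum_(i <- s) l i.
Proof.
elim: s => [|i s IH] ul.
  by under eq_fun do rewrite big_nil; rewrite big_nil; exact: cvg_cst.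
under eq_fun do rewrite big_cons; rewrite big_cons; apply: cvgD.
  by apply: ul; rewrite mem_head.
by apply: IH => j js; apply: ul; rewrite inE js orbT.
Qed.

Variable q : K.
Hypothesis q_lt1 : `|q| < 1.
Hypothesis cvg_q : q ^+ n @[n --> \oo] --> (0 : K).

Lemma norm_expr_lt1 m : (0 < m)%N -> `|q ^+ m| < 1.
Proof. by move=> m0; rewrite normrX exprn_ilt1 // -lt0n. Qed.

Lemma subr1_expr_neq0 m : (0 < m)%N -> 1 - q ^+ m != 0.
Proof.
move=> /norm_expr_lt1; rewrite subr_eq0; apply: contraTneq => <-.
by rewrite normr1 ltxx.
Qed.

Lemma addr1_expr_neq0 m : (0 < m)%N -> 1 + q ^+ m != 0.
Proof.
move=> /norm_expr_lt1; rewrite addrC addr_eq0; apply: contraTneq => ->.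
by rewrite normrN1 ltxx.
Qed.

Lemma cvg_exprM m : (0 < m)%N -> (q ^+ m) ^+ n @[n --> \oo] --> (0 : K).
Proof.
case: m => // m _; under eq_fun do rewrite -exprM mulnC exprM exprS.
(* One factor tending to [0] is singled out because [m] may be [0] here, and then the remaining
   power is constantly [1]. *)
rewrite -[0](mul0r ((0 : K) ^+ m)); apply: cvgM => //.
have := @cvg_prod_seq 'I_m (index_enum _) (fun=> (fun n => q ^+ n))
  (fun=> 0) (fun=> cvg_q).
by under eq_fun do rewrite prodr_const card_ord; rewrite prodr_const card_ord.
Qed.

Lemma cvg_geometric_sum m : (0 < m)%N ->
  \sum_(i < n) (q ^+ m) ^+ i @[n --> \oo] --> (1 - q ^+ m)^-1.
Proof.
move=> m0; have x1 := subr1_expr_neq0 m0; set x := q ^+ m in x1 *.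
have geoE n : \sum_(i < n) x ^+ i = (1 - x ^+ n) * (1 - x)^-1.
  apply: (mulIf x1); rewrite mulfVK // mulrC.
  by rewrite -[RHS]opprB subrX1 -mulNr opprB.
under eq_fun do rewrite geoE.
have h : (1 - x ^+ n) * (1 - x)^-1 @[n --> \oo] --> (1 - 0) * (1 - x)^-1.
  apply: cvgM; last exact: cvg_cst.
  by apply: cvgB; [exact: cvg_cst|exact: cvg_exprM].
by rewrite subr0 mul1r in h.
Qed.

(** Split by the overlined bit, with [x] for [q ^+ m]. If it is set, presence is automatic and the
    limit is [x / (1 - x)]; if not, requiring presence leaves the geometric series from
    [x ^+ (r - 1)] on. *)
Lemma cvg_local_factor r m D : (1 < r)%N -> (0 < m)%N ->
  local_factor r L D (q ^+ m) @[L --> \oo] -->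
    (if D then q ^+ m * (1 + q ^+ ((r - 2) * m)) else 1 + q ^+ m) / (1 - q ^+ m).
Proof.
move=> r1 m0; have gs := cvg_geometric_sum m0.
rewrite mulnC exprM; set x := q ^+ m in gs *.
have gs1 : \sum_(i < n.+1) x ^+ i @[n --> \oo] --> (1 - x)^-1.
  by rewrite -(@cvg_shiftS _ (fun n => \sum_(i < n) x ^+ i)) in gs.
have gs2 : \sum_(i < n.+1) (r - 1 <= i)%:R * x ^+ i @[n --> \oo] -->
    x ^+ (r - 1) * (1 - x)^-1.
  (* After a shift by [r - 1] the sum splits into [r - 1] zero terms and [x ^+ (r - 1)] times a full
     geometric sum. *)
  rewrite (@cvg_shiftS _ (fun n => \sum_(i < n) (r - 1 <= i)%:R * x ^+ i)).
  rewrite -(cvg_shiftn (r - 1)) /=.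
  under eq_fun => n.
    rewrite addnC big_split_ord /= big1 ?add0r; last first.
      by move=> i _; rewrite leqNgt ltn_ord mul0r.
    under eq_bigr do rewrite leq_addr mul1r exprD.
    rewrite -mulr_sumr.
    over.
  by apply: cvgM => //; exact: cvg_cst.
have lfE L : local_factor r L D x =
    (\sum_(i < L.+1) (if D then (r - 1 <= i)%:R else 1) * x ^+ i)
      + x * \sum_(i < L.+1) x ^+ i.
  rewrite /local_factor -(pair_bigA _ (fun b (c : 'I_L.+1) =>
    (D ==> (b || (r - 1 <= c)%N))%:R * x ^+ (b + c))) /= big_bool /= addrC.
  congr (_ + _); first by apply: eq_bigr => i _; case: (D).
  by rewrite mulr_sumr; apply: eq_bigr => i _; rewrite implybT mul1r exprS.
under eq_fun do rewrite lfE.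
have -> : (if D then x * (1 + x ^+ (r - 2)) else 1 + x) / (1 - x) =
    (if D then x ^+ (r - 1) else 1) / (1 - x) + x * (1 - x)^-1.
  have -> : (r - 1 = (r - 2).+1)%N.
    by case: (r) r1 => [|[]] // ? _; rewrite !subSS !subn0.
  by rewrite -mulrDl; congr (_ / _); case: (D); rewrite // mulrDr mulr1 -exprS addrC.
apply: cvgD; last by apply: cvgM => //; exact: cvg_cst.
case: D lfE => _ //.
by under eq_fun do under eq_bigr do rewrite mul1r; rewrite mul1r.
Qed.

End LocalLimits.

(** The limit of the local factor at size [m] with presence required, divided by the one without. *)
Definition mes_ratio (K : fieldType) (r : nat) (q : K) (m : nat) : K :=
  q ^+ m * (1 + q ^+ ((r - 2) * m)) / (1 + q ^+ m).

(** The exponents [a + t * A] for [t < k] add up to [A * 'C(k, 2) + k * a], and the two Pochhammer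
    symbols collect the remaining factors of the ratios. *)
Lemma mes_coefE (K : fieldType) (r A a k : nat) (q : K) :
  q ^+ (A * 'C(k, 2) + k * a) / qpoch (- q ^+ a) (q ^+ A) k
    * qpoch (- q ^+ ((r - 2) * a)) (q ^+ ((r - 2) * A)) k
  = \prod_(t <- iota 0 k) mes_ratio r q (a + t * A).
Proof.
elim: k => [|k IH]; first by rewrite /qpoch !big_geq // muln0 big_nil divr1 mulr1.
rewrite -addn1 iotaD big_cat big_seq1 -IH add0n addn1 /qpoch !big_nat_recr //=.
have e n : - q ^+ (n * a) * (q ^+ (n * A)) ^+ k = - q ^+ (n * (a + k * A)).
  by rewrite -exprM mulNr -exprD mulnDr -!mulnA [(A * k)%N]mulnC.
have e1 := e 1; rewrite !mul1n in e1; rewrite e1 e !opprK /mes_ratio.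
have -> : (A * 'C(k.+1, 2) + k.+1 * a = A * 'C(k, 2) + k * a + (a + k * A))%N.
  rewrite binS bin1 mulnDr mulSn [(A * k)%N]mulnC.
  by rewrite [(a + k * a)%N]addnC -!addnA; congr addn;
    rewrite addnCA [(_ + a)%N]addnC.
by rewrite exprD invfM [X in X * _ = _]mulrACA [LHS]mulrACA; congr (_ * _);
  rewrite mulrAC.
Qed.

Section TruncatedGenfun.
Variables (K : numFieldType) (q : K).
Hypothesis q_lt1 : `|q| < 1.

Lemma prod_local_limit (r A a k M : nat) : (0 < a)%N -> (0 < A)%N ->
    {in iota 0 k, forall t, (a + t * A <= M)%N} ->
  \prod_(i < M) ((if i.+1 \in [seq (a + t * A)%N | t <- iota 0 k]
      then q ^+ i.+1 * (1 + q ^+ ((r - 2) * i.+1)) else 1 + q ^+ i.+1)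
        / (1 - q ^+ i.+1))
  = qpoch (- q) q M / qpoch q q M
      * \prod_(t <- iota 0 k) mes_ratio r q (a + t * A).
Proof.
move=> a0 A0 kM; set s := map _ _.
rewrite (eq_bigr (fun i : 'I_M => (1 + q ^+ i.+1) / (1 - q ^+ i.+1) *
    (if i.+1 \in s then mes_ratio r q i.+1 else 1))); last first.
  move=> i _; case: ifP => _; last by rewrite mulr1.
  rewrite /mes_ratio [RHS]mulrC -!mulrA; congr (_ * (_ * _)).
  by rewrite mulKf // (addr1_expr_neq0 q_lt1).
rewrite big_split /= prodf_div /qpoch !big_mkord; congr (_ / _ * _).
- by apply: eq_bigr => i _; rewrite mulNr opprK exprS.
- by apply: eq_bigr => i _; rewrite exprS.
(* Pass from indices to sizes and keep the required ones; they are distinct as [A] is positive, so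
   they form a permutation of [s]. *)
rewrite -(big_mkord xpredT (fun i => if i.+1 \in s then mes_ratio r q i.+1 else 1)).
rewrite -(big_add1 _ _ 0 M.+1 xpredT
  (fun i => if i \in s then mes_ratio r q i else 1)).
rewrite -big_mkcond -big_filter /=.
rewrite -[RHS](big_map (fun t => (a + t * A)%N) xpredT (mes_ratio r q)) -/s.
apply: perm_big; apply: uniq_perm.
- by rewrite filter_uniq // iota_uniq.
- rewrite map_inj_uniq ?iota_uniq // => t u /addnI /eqP.
  by rewrite eqn_pmul2r // => /eqP.
move=> m; rewrite mem_filter mem_index_iota andb_idr // => /mapP[t /kM tM ->].
by rewrite addn_gt0 a0 /= ltnS.
Qed.

Hypothesis cvg_q : q ^+ n @[n --> \oo] --> (0 : K).

(** Parts bounded by [N * A] let [mes_eq] stop at [k = N]. Convergence of the powers of [q] is a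
    hypothesis so that the result serves the real and the complex field alike. *)
Lemma cvg_truncated_genfun (r A a N : nat) :
    (0 < a)%N -> (a <= A)%N -> (1 < r)%N ->
  \sum_(f : {ffun 'I_(N * A) -> bool * 'I_L.+1})
    (mes r A a (opart_ffun f))%:R * q ^+ weight f @[L --> \oo] -->
  qpoch (- q) q (N * A) / qpoch q q (N * A) *
    (a%:R + A%:R * \sum_(1 <= k < N.+1)
       \prod_(t <- iota 0 k) mes_ratio r q (a + t * A)).
Proof.
move=> a0 aA r1; have A0 := leq_trans a0 aA.
pose P k L := \prod_(i < N * A)
  local_factor r L (i.+1 \in [seq (a + t * A)%N | t <- iota 0 k]) (q ^+ i.+1).
have kM k : (k <= N)%N -> {in iota 0 k, forall t, (a + t * A <= N * A)%N}.
  move=> kN t; rewrite mem_iota /= add0n => tk.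
  by apply: (@leq_trans (t.+1 * A));
    rewrite ?leq_mul2r ?(leq_trans tk) ?orbT // mulSn leq_add2r.
have sumE L : \sum_(f : {ffun 'I_(N * A) -> bool * 'I_L.+1})
    (mes r A a (opart_ffun f))%:R * q ^+ weight f =
    a%:R * P 0 L + A%:R * \sum_(1 <= k < N.+1) P k L.
  under [X in _ = _ * _ + _ * X]eq_big_nat => k /andP[_ kN].
    rewrite /P -truncated_genfun //; last exact: kM.
    over.
  rewrite /P -truncated_genfun //= exchange_big /= !mulr_sumr -big_split /=.
  apply: eq_bigr => f _; rewrite mul1r (@mes_eq r A a N) //; last first.
    by move=> m /mapP[x /opart_of_bounded/andP[_ xM] ->].
  by rewrite natrD natrM natr_sum mulrDl -mulr_suml mulrA.
under eq_fun do rewrite sumE.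
have cvgP k : (k <= N)%N -> P k L @[L --> \oo] -->
    qpoch (- q) q (N * A) / qpoch q q (N * A) *
    \prod_(t <- iota 0 k) mes_ratio r q (a + t * A).
  move=> kN; rewrite -prod_local_limit //; last exact: kM.
  by apply: cvg_prod_seq => i; apply: cvg_local_factor.
rewrite mulrDr; apply: cvgD.
  rewrite mulrC; apply: cvgM; first exact: cvg_cst.
  by have := cvgP 0 isT; rewrite big_nil mulr1.
rewrite mulrCA; apply: cvgM; first exact: cvg_cst.
rewrite mulr_sumr; apply: cvg_sum_seq => k; rewrite mem_index_iota => /andP[_ kN].
exact: cvgP.
Qed.

End TruncatedGenfun.

(** * Convergence of complex sequences *)

Section ComplexConvergence.
Variable R : realType.
Local Notation C := (R[i] : numFieldType).
Implicit Types (u : nat -> C) (t : nat -> R).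

(** Positive elements of [R[i]] have zero imaginary part, so the epsilons of complex limits are
    real. *)
Lemma complex_gt0 (e : R[i]) : 0 < e -> exists2 d : R, 0 < d & e = d%:C.
Proof.
by rewrite ltcE /= => /andP[/eqP Ime Ree]; exists (complex.Re e) => //;
  case: e Ime {Ree} => x y /= ->.
Qed.

Lemma cvg_complex_dominated u (l : C) t :
    (forall n, `|l - u n| <= (t n)%:C) -> t n @[n --> \oo] --> (0 : R) ->
  u n @[n --> \oo] --> l.
Proof.
move=> ut /cvgrPdist_lt t0; apply/cvgrPdist_lt => e /complex_gt0[d d0 ->].
have := t0 d d0; apply: filterS => n; rewrite sub0r normrN => tn.
apply: le_lt_trans (ut n) _; rewrite ltcR.
exact: le_lt_trans (ler_norm _) tn.
Qed.

Lemma cvg_expr_complex (q : C) : `|q| < 1 -> q ^+ n @[n --> \oo] --> (0 : C).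
Proof.
move=> q1; apply: (@cvg_complex_dominated _ _ (fun n => Normc.normc q ^+ n)).
  by move=> n; rewrite sub0r normrN normrX rmorphXn.
apply: cvg_expr; rewrite ger0_norm; last by rewrite -lecR; exact: (normr_ge0 q).
by rewrite -ltcR.
Qed.

Lemma nondecreasing_sum_is_cvg t (B : R) : (forall n, 0 <= t n) ->
  (forall n, \sum_(0 <= i < n) t i <= B) -> cvgn (series t).
Proof.
move=> t0 tB; apply: nondecreasing_is_cvgn.
  by apply/nondecreasing_seqP => n; rewrite /series /= big_nat_recr //= lerDl.
by exists B => _ [n _ <-]; exact: tB.
Qed.

(** The increments form an absolutely convergent telescoping series. Phrased by increments, the
    criterion fits partial sums and partial products. *)
Lemma is_cvg_steps (v : nat -> R) t (B : R) : (forall n, `|v n.+1 - v n| <= t n) ->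
  (forall n, \sum_(0 <= i < n) t i <= B) -> cvgn v.
Proof.
move=> vt tB; have t0 n : 0 <= t n by exact: le_trans (vt n).
have cs : cvgn (series (telescope v)).
  apply: normed_cvg; apply: (series_le_cvg (v_ := t)) => //.
    by move=> n /=.
  exact: nondecreasing_sum_is_cvg t0 tB.
have -> : v = (fun n => v 0%N + series (telescope v) n).
  by apply/funext => n; rewrite -eq_sum_telescope.
by apply: is_cvgD => //; exact: is_cvg_cst.
Qed.

Lemma normc_ge_Re_Im (z : R[i]) :
  `|complex.Re z|%:C <= `|z| /\ `|complex.Im z|%:C <= `|z|.
Proof.
case: z => x y; rewrite normc_def !lecR /=; split; rewrite -sqrtr_sqr ler_wsqrtr //.
  by rewrite lerDl sqr_ge0.
by rewrite lerDr sqr_ge0.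
Qed.

Lemma is_cvg_complex_steps u t (B : R) : (forall n, `|u n.+1 - u n| <= (t n)%:C) ->
  (forall n, \sum_(0 <= i < n) t i <= B) -> cvgn u.
Proof.
move=> ut tB.
have ReB (x y : R[i]) : complex.Re (x - y) = complex.Re x - complex.Re y.
  by case: x y => [? ?] [].
have ImB (x y : R[i]) : complex.Im (x - y) = complex.Im x - complex.Im y.
  by case: x y => [? ?] [].
have cRe : cvgn (fun n => complex.Re (u n)).
  apply: is_cvg_steps tB => n; rewrite -ReB -lecR.
  exact: le_trans (normc_ge_Re_Im _).1 (ut n).
have cIm : cvgn (fun n => complex.Im (u n)).
  apply: is_cvg_steps tB => n; rewrite -ImB -lecR.
  exact: le_trans (normc_ge_Re_Im _).2 (ut n).
move: cRe cIm => /cvg_ex[x cx] /cvg_ex[y cy]; apply/cvg_ex; exists (x +i* y).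
apply: (@cvg_complex_dominated _ _
  (fun n => `|x - complex.Re (u n)| + `|y - complex.Im (u n)|)).
  move=> n; rewrite [_ - u n]complexE ReB ImB /=.
  apply: le_trans (ler_normD _ _) _; rewrite normrM.
  have -> : `|'i%C| = 1 :> R[i] by rewrite normc_def /= expr0n expr1n add0r sqrtr1.
  rewrite mul1r [leRHS]rmorphD.
  by apply: lerD; rewrite normc_def /= expr0n addr0 sqrtr_sqr.
have cvg_dist (v : nat -> R) (l : R) :
    v n @[n --> \oo] --> l -> `|l - v n| @[n --> \oo] --> (0 : R).
  move=> vl; rewrite -(normr0 R) -(subrr l).
  by apply: cvg_norm; apply: cvgB => //; exact: cvg_cst.
by rewrite -[0]addr0; apply: cvgD; exact: cvg_dist.
Qed.

End ComplexConvergence.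

(** * Bounds on products *)

Section GeometricBounds.
Variable (R : realType) (rho : R).
Hypotheses (rho_ge0 : 0 <= rho) (rho_lt1 : rho < 1).

Let rho1_gt0 : 0 < 1 - rho. Proof. by rewrite subr_gt0. Qed.

Lemma geometric_sum_le n : \sum_(0 <= i < n) rho ^+ i <= (1 - rho)^-1.
Proof.
rewrite -[leRHS]mul1r ler_pdivlMr // mulrC big_mkord.
by rewrite -opprB mulNr -subrX1 opprB gerBl exprn_ge0.
Qed.

Lemma prod_1D_geometric_le (c : R) n : 0 <= c ->
  \prod_(0 <= i < n) (1 + c * rho ^+ i) <= expR (c / (1 - rho)).
Proof.
move=> c0; apply: (@le_trans _ _ (\prod_(0 <= i < n) expR (c * rho ^+ i))).
  apply: ler_prod => i _; rewrite expR_ge1Dx andbT.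
  by rewrite addr_ge0 // mulr_ge0 // exprn_ge0.
by rewrite -expR_sum ler_expR -mulr_sumr ler_wpM2l // geometric_sum_le.
Qed.

(** For [0 <= y <= rho] one has [1 - y >= expR (- (y / (1 - rho)))]; with [y = rho * rho ^+ i] the
    exponents are summed geometrically. *)
Lemma qpoch_real_ge n : expR (- (rho / (1 - rho) / (1 - rho))) <= qpoch rho rho n.
Proof.
apply: (@le_trans _ _
  (\prod_(0 <= i < n) (expR (rho / (1 - rho) * rho ^+ i))^-1)).
  under eq_bigr do rewrite -expRN.
  rewrite -expR_sum ler_expR sumrN lerN2 -mulr_sumr ler_wpM2l ?geometric_sum_le //.
  by rewrite divr_ge0 // ltW.
apply: ler_prod => i _; rewrite invr_ge0 expR_ge0 /=.
have y0 : 0 <= rho * rho ^+ i by rewrite mulr_ge0 ?exprn_ge0.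
have y1 : rho * rho ^+ i <= rho.
  by rewrite ler_piMr // exprn_ile1 // ltW.
rewrite mulrAC; set y := rho * rho ^+ i in y0 y1 *.
have y2 : 0 < 1 - y by rewrite subr_gt0 (le_lt_trans y1).
rewrite -[leRHS]invrK lef_pV2 ?posrE ?expR_gt0 ?invr_gt0 //.
apply: le_trans (expR_ge1Dx _); rewrite -[leLHS]mul1r ler_pdivrMr //.
have -> : (1 + y / (1 - rho)) * (1 - y) = 1 + y * (rho - y) / (1 - rho).
  by field; rewrite gt_eqF.
rewrite lerDl; apply: divr_ge0; last exact: ltW.
by rewrite mulr_ge0 // subr_ge0.
Qed.

(** The product of the bounds of [norm_mes_ratio_le], hence a majorant of the [k]-th coefficient. *)
Definition mes_dominant k : R := \prod_(t <- iota 0 k) (2 / (1 - rho) * rho ^+ t).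

Lemma mes_dominant_ge0 k : 0 <= mes_dominant k.
Proof.
by apply: prodr_ge0 => t _; rewrite mulr_ge0 ?exprn_ge0 // divr_ge0 // ltW.
Qed.

(* Doubling each factor costs only a convergent product, whence the decay in
   [2 ^- k]. *)
Lemma mes_dominant_le k :
  mes_dominant k <= expR (4 / (1 - rho) / (1 - rho)) * 2^-1 ^+ k.
Proof.
have c0 : 0 <= 4 / (1 - rho) by rewrite divr_ge0 // ltW.
rewrite exprVn ler_pdivlMr ?exprn_gt0 //.
have -> : mes_dominant k * 2 ^+ k = \prod_(0 <= t < k) (4 / (1 - rho) * rho ^+ t).
  rewrite /mes_dominant -[X in iota 0 X]subn0 !big_mkord.
  rewrite -[X in 2 ^+ X](card_ord k) -prodr_const -big_split /=.
  by apply: eq_bigr => t _; field; rewrite gt_eqF.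
apply: le_trans (prod_1D_geometric_le k c0); apply: ler_prod => t _.
by rewrite lerDr ler01 andbT mulr_ge0 ?exprn_ge0.
Qed.

Lemma sum_mes_dominant_le n :
  \sum_(0 <= k < n) mes_dominant k <= expR (4 / (1 - rho) / (1 - rho)) * 2.
Proof.
apply: (@le_trans _ _
  (\sum_(0 <= k < n) expR (4 / (1 - rho) / (1 - rho)) * 2^-1 ^+ k)).
  by apply: ler_sum => k _; exact: mes_dominant_le.
rewrite -mulr_sumr ler_wpM2l ?expR_ge0 // big_mkord.
have := subrX1 (2^-1 : R) n.
have : 0 <= (2^-1 : R) ^+ n by rewrite exprn_ge0 // invr_ge0.
by lra.
Qed.

End GeometricBounds.

(** With [m = a + t * A], the factor [1 + q ^+ ((r - 2) * m)] has norm at most [2], the denominator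
    at least [1 - |q|], and [m >= t]. *)
Lemma norm_mes_ratio_le (K : numFieldType) (q : K) (r A a t : nat) :
    `|q| < 1 -> (0 < a)%N -> (0 < A)%N ->
  `|mes_ratio r q (a + t * A)| <= 2 / (1 - `|q|) * `|q| ^+ t.
Proof.
move=> q1 a0 A0; have q1' := ltW q1; have q2 : 0 < 1 - `|q| by rewrite subr_gt0.
rewrite /mes_ratio !normrM normfV normrX; set m := (a + t * A)%N.
have m0 : (0 < m)%N by rewrite addn_gt0 a0.
rewrite -mulrA mulrC ler_pM ?mulr_ge0 ?invr_ge0 ?exprn_ge0 //.
  apply: ler_pM; rewrite ?invr_ge0 //.
    apply: le_trans (ler_normD _ _) _; rewrite normr1 [2]mulr2n lerD2l normrX.
    exact: exprn_ile1.
  rewrite lef_pV2 ?posrE // ?normr_gt0 ?addr1_expr_neq0 //.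
  have := lerB_normD (1 : K) (q ^+ m); rewrite normr1 normrX; apply: le_trans.
  by rewrite lerD2l lerN2 -[leRHS]expr1 ler_wiXn2l.
apply: ler_wiXn2l => //; apply: leq_trans (leq_addl _ _).
by rewrite leq_pmulr.
Qed.

(** * Convergence and non-vanishing of the infinite products *)

Section ComplexPochhammer.
Variable (R : realType).
Local Notation C := (R[i] : numFieldType).
Variables (q : C).
Hypothesis q_lt1 : `|q| < 1.
Let rho : R := Normc.normc q.

Lemma normc_ge0 (z : C) : 0 <= Normc.normc z.
Proof. by rewrite -lecR; exact: (normr_ge0 z). Qed.

Lemma normc_lt1 : rho < 1. Proof. by rewrite -ltcR. Qed.

(** The increment at [n] is [- x * q ^+ n] times a partial product, and the partial products are
    bounded by [E], so increments decay geometrically. *)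
Lemma is_cvg_qpoch (x : C) : cvgn (qpoch x q).
Proof.
pose c := Normc.normc x; pose E := expR (c / (1 - rho)).
have c0 : 0 <= c := normc_ge0 x; have r0 : 0 <= rho := normc_ge0 q.
have qE n : `|qpoch x q n| <= E%:C.
  have := prod_1D_geometric_le r0 normc_lt1 n c0; rewrite -lecR.
  apply: le_trans; rewrite normr_prod rmorph_prod; apply: ler_prod => i _.
  rewrite normr_ge0 /= rmorphD rmorph1 rmorphM rmorphXn.
  by rewrite (le_trans (ler_normB _ _)) // normr1 normrM normrX.
apply: (@is_cvg_complex_steps _ _ (fun n => E * (c * rho ^+ n))
  (E * (c * (1 - rho)^-1))).
  move=> n; rewrite /qpoch big_nat_recr //= -/(qpoch x q n).
  rewrite mulrBr mulr1 addrAC subrr add0r normrN normrM [X in _ <= X]rmorphM.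
  rewrite ler_pM //.
  by rewrite normrM normrX rmorphM rmorphXn.
move=> n; rewrite -!mulr_sumr; apply: ler_wpM2l; first exact: expR_ge0.
by apply: ler_wpM2l => //; exact: geometric_sum_le normc_lt1 _.
Qed.

(** Comparison with the real product at [rho] keeps the norms of all partial products above one
    positive constant. *)
Lemma qpoch_inf_neq0 : qpoch_inf q q != 0.
Proof.
pose d := expR (- (rho / (1 - rho) / (1 - rho))).
have qd n : d%:C <= `|qpoch q q n|.
  have := qpoch_real_ge (normc_ge0 q) normc_lt1 n; rewrite -lecR => /le_trans; apply.
  rewrite normr_prod rmorph_prod; apply: ler_prod => i _.
  apply/andP; split.
    by rewrite ler0c subr_ge0 -exprS exprn_ile1 ?normc_ge0 // ltW // normc_lt1.
  rewrite rmorphB rmorph1 -!exprS rmorphXn.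
  by have := lerB_dist 1 (q ^+ i.+1); rewrite normr1 normrX.
apply/eqP => q0; have := @is_cvg_qpoch q; rewrite -/(qpoch_inf q q).
move/cvgrPdist_lt => /(_ d%:C); rewrite ltcR expR_gt0 => /(_ isT)[N _].
move=> /(_ N (leqnn N)) /=; rewrite -/(qpoch_inf q q) q0 sub0r normrN.
by move/lt_le_trans/(_ (qd N)); rewrite ltxx.
Qed.

End ComplexPochhammer.

(** * The generating function *)

(** Group the assignments by weight: below [N] the cutoffs lose nothing, and from [N] on they can
    only lower the coefficients. *)
Lemma truncated_genfun_split (S : comNzRingType) (q : S) (r A a M L N : nat) :
    (N <= M)%N -> (N <= L)%N ->
  exists2 tau : nat -> nat, (forall n, tau n <= sigma_mes r A a n)%N &
  exists W, \sum_(f : {ffun 'I_M -> bool * 'I_L.+1})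
    (mes r A a (opart_ffun f))%:R * q ^+ weight f =
  \sum_(0 <= n < N) (sigma_mes r A a n)%:R * q ^+ n
    + \sum_(N <= n < W) (tau n)%:R * q ^+ n.
Proof.
move=> NM NL; set F := ({ffun _ -> _})%type.
exists (fun n => \sum_(f : F | weight f == n) mes r A a (opart_ffun f))%N.
  by move=> n; exact: sum_mes_truncated_le.
(* The maximum puts [W] above every weight; the summand [N] allows the split at [N]. *)
exists (N + \max_(f : F) (weight f).+1)%N; set W := (N + _)%N.
transitivity (\sum_(0 <= n < W)
    (\sum_(f : F | weight f == n) mes r A a (opart_ffun f))%:R * q ^+ n).
  under [RHS]eq_bigr do rewrite natr_sum mulr_suml.
  rewrite (exchange_big_dep xpredT) //=; apply: eq_bigr => f _.
  under [RHS]eq_bigl do rewrite eq_sym.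
  rewrite big_nat1_eq ifT //=; apply: leq_trans (leq_addl _ _).
  exact: (leq_bigmax f).
rewrite (big_cat_nat (n := N)) ?leq_addr //=; congr (_ + _).
apply: eq_big_nat => n /andP[_ nN].
by rewrite sum_mes_truncated // ltnW // (leq_trans nN).
Qed.

Section RealBound.
Variables (R : realType) (rho : R) (r A a : nat).
Hypotheses (rho_ge0 : 0 <= rho) (rho_lt1 : rho < 1).
Hypotheses (a_gt0 : (0 < a)%N) (a_le_A : (a <= A)%N) (r_gt1 : (1 < r)%N).

Let A_gt0 : (0 < A)%N. Proof. exact: leq_trans a_le_A. Qed.
Let norm_rho_lt1 : `|rho| < 1. Proof. by rewrite ger0_norm. Qed.

Lemma sum_sigma_mes_bounded : exists B : R,
  forall N, \sum_(0 <= n < N) (sigma_mes r A a n)%:R * rho ^+ n <= B.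
Proof.
(* [E1] bounds the product in the numerator, [E2] bounds the one in the denominator from below, and
   [E3] bounds the sum over [k]. *)
pose E1 := expR (rho / (1 - rho)).
pose E2 := expR (- (rho / (1 - rho) / (1 - rho))).
pose E3 := expR (4 / (1 - rho) / (1 - rho)) * 2.
exists (E1 / E2 * (a%:R + A%:R * E3)) => N.
pose T := qpoch (- rho) rho (N * A) / qpoch rho rho (N * A) *
    (a%:R + A%:R * \sum_(1 <= k < N.+1)
       \prod_(t <- iota 0 k) mes_ratio r rho (a + t * A)).
apply: (@le_trans _ _ T).
  have := cvg_truncated_genfun (N := N) norm_rho_lt1
    (cvg_expr norm_rho_lt1) a_gt0 a_le_A r_gt1.
  (* For [L >= N] the truncated sum is the partial sum plus nonnegative terms, so its limit [T] is
     at least the partial sum. *)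
  move/cvgr_to_ge; apply; exists N => // L /= NL.
  have [||tau _ [W ->]] := @truncated_genfun_split R rho r A a (N * A) L N.
  - by rewrite leq_pmulr.
  - exact: NL.
  - by rewrite lerDl sumr_ge0 // => n _; rewrite mulr_ge0 // exprn_ge0.
have mr_ge0 m : 0 <= mes_ratio r rho m.
  by rewrite divr_ge0 ?mulr_ge0 ?addr_ge0 ?exprn_ge0.
apply: ler_pM.
- rewrite divr_ge0 // prodr_ge0 // => i _.
    by rewrite mulNr opprK addr_ge0 // mulr_ge0 // exprn_ge0.
  by rewrite subr_ge0 -exprS exprn_ile1 // ltW.
- rewrite addr_ge0 // mulr_ge0 // sumr_ge0 // => k _.
  by rewrite prodr_ge0.
- have qE2 := qpoch_real_ge rho_ge0 rho_lt1 (N * A).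
  have E2_gt0 : 0 < E2 := expR_gt0 _.
  apply: ler_pM.
  + by rewrite prodr_ge0 // => i _;
      rewrite mulNr opprK addr_ge0 // mulr_ge0 // exprn_ge0.
  + by rewrite invr_ge0 (le_trans _ qE2) // expR_ge0.
  + apply: le_trans (prod_1D_geometric_le rho_ge0 rho_lt1 (N * A) rho_ge0).
    by rewrite /qpoch; under eq_bigr do rewrite mulNr opprK.
  + by rewrite lef_pV2 ?posrE // (lt_le_trans E2_gt0).
- rewrite lerD2l ler_wpM2l //.
  apply: le_trans (sum_mes_dominant_le rho_ge0 rho_lt1 N.+1).
  rewrite [leRHS]big_ltn // ler_wpDl ?mes_dominant_ge0 //.
  apply: ler_sum => k _; apply: ler_prod => t _; rewrite mr_ge0 /=.
  have := norm_mes_ratio_le r t norm_rho_lt1 a_gt0 A_gt0.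
  by rewrite !ger0_norm.
Qed.

End RealBound.

Section ComplexGenfun.
Variable (R : realType).
Local Notation C := (R[i] : numFieldType).
Variables (q : C) (r A a : nat).
Hypothesis q_lt1 : `|q| < 1.
Hypotheses (a_gt0 : (0 < a)%N) (a_le_A : (a <= A)%N) (r_gt1 : (1 < r)%N).

Let A_gt0 : (0 < A)%N. Proof. exact: leq_trans a_le_A. Qed.
Let rho : R := Normc.normc q.
Let rho_ge0 : 0 <= rho := normc_ge0 q.
Let rho_lt1 : rho < 1 := normc_lt1 q_lt1.

Lemma is_cvg_sum_mes_ratio :
  cvgn (fun N => \sum_(1 <= k < N) \prod_(t <- iota 0 k) mes_ratio r q (a + t * A)).
Proof.
pose u N := \sum_(1 <= k < N) \prod_(t <- iota 0 k) mes_ratio r q (a + t * A).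
(* The sum from [1] is empty at both [0] and [1]; after the shift every increment is a single
   term. *)
suff /cvg_ex[l ul] : cvgn (fun N => u N.+1).
  by apply/cvg_ex; exists l; rewrite -(@cvg_shiftS _ u).
have [B HB] : exists B, forall n, \sum_(0 <= k < n) mes_dominant rho k.+1 <= B.
  exists (expR (4 / (1 - rho) / (1 - rho)) * 2) => n.
  apply: le_trans (sum_mes_dominant_le rho_ge0 rho_lt1 n.+1).
  by rewrite [leRHS]big_nat_recl // lerDr mes_dominant_ge0.
apply: (@is_cvg_complex_steps R (fun N => u N.+1)
  (fun k => mes_dominant rho k.+1) B _ HB) => n.
rewrite /u big_nat_recr //= addrAC subrr add0r normr_prod rmorph_prod.
apply: ler_prod => t _; rewrite normr_ge0 /=.
apply: le_trans (norm_mes_ratio_le _ _ q_lt1 a_gt0 A_gt0) _.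
by rewrite !(rmorphM, fmorphV, rmorphB, rmorph1, rmorphXn, rmorph_nat).
Qed.

Lemma cvg_sum_sigma_mes :
  \sum_(0 <= n < N) (sigma_mes r A a n)%:R * q ^+ n @[N --> \oo] -->
  qpoch_inf (- q) q / qpoch_inf q q * (a%:R + A%:R *
    infsum 1 (fun k => \prod_(t <- iota 0 k) mes_ratio r q (a + t * A))).
Proof.
pose T N := qpoch (- q) q (N * A) / qpoch q q (N * A) *
    (a%:R + A%:R * \sum_(1 <= k < N.+1)
       \prod_(t <- iota 0 k) mes_ratio r q (a + t * A)).
pose Z N := \sum_(0 <= n < N) (sigma_mes r A a n)%:R * q ^+ n.
pose U N := \sum_(0 <= n < N) (sigma_mes r A a n)%:R * rho ^+ n.
have cvgU : cvgn U.
  have [B HB] := sum_sigma_mes_bounded rho_ge0 rho_lt1 a_gt0 a_le_A r_gt1.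
  apply: nondecreasing_sum_is_cvg HB => n.
  by rewrite mulr_ge0 // exprn_ge0.
have U_le n : U n <= limn U.
  apply: nondecreasing_cvgn_le => //; apply/nondecreasing_seqP => k.
  by rewrite /U big_nat_recr //= lerDl mulr_ge0 // exprn_ge0.
(* Up to an arbitrary [e], [T N] is a truncated sum with large [L]. That sum exceeds [Z N] by [Y],
   whose norm is at most a piece of the tail of [U]. *)
have TZ N : `|T N - Z N| <= (limn U - U N)%:C.
  apply/ler_addgt0Pr => e e0.
  have := cvg_truncated_genfun (N := N) q_lt1 (cvg_expr_complex q_lt1)
    a_gt0 a_le_A r_gt1.
  move/cvgrPdist_lt => /(_ _ e0)[L0 _ /(_ (L0 + N)%N (leq_addr _ _)) /= TL].
  have [||tau tau_le [W WE]] := @truncated_genfun_split C q r A a (N * A) (L0 + N) N.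
  - by rewrite leq_pmulr.
  - exact: leq_addl.
  rewrite WE -/(T N) -/(Z N) in TL.
  set Y := \sum_(N <= n < W) _ in TL.
  have -> : T N - Z N = Y + (T N - (Z N + Y)) by ring.
  apply: le_trans (ler_normD _ _) _; apply: lerD; last exact: ltW.
  apply: le_trans (ler_norm_sum _ _ _) _.
  apply: (@le_trans _ _ (\sum_(N <= n < W) (sigma_mes r A a n)%:R * rho ^+ n)%:C).
    rewrite rmorph_sum; apply: ler_sum => n _.
    rewrite normrM normrX normr_nat rmorphM rmorph_nat rmorphXn.
    by rewrite ler_wpM2r ?exprn_ge0 // ler_nat.
  rewrite lecR lerBrDl; have [NW|WN] := leqP N W.
    by rewrite -big_cat_nat //; exact: U_le.
  by rewrite [X in _ + X]big_geq ?addr0 ?U_le // ltnW.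
set l := _ * (_ + _).
have cvgT : T N @[N --> \oo] --> l.
  (* The products in [T] run along the subsequence of multiples of [A], unbounded as [A] is
     positive. *)
  have sub (x : C) : qpoch x q (N * A) @[N --> \oo] --> qpoch_inf x q.
    have h : qpoch x q n @[n --> \oo] --> qpoch_inf x q by exact: is_cvg_qpoch.
    exact: (cvg_comp (fun N => (N * A)%N) (qpoch x q) (@cvg_mulnr A A_gt0) h).
  apply: cvgM.
    by apply: cvgM => //; apply: cvgV => //; exact: qpoch_inf_neq0.
  apply: cvgD; first exact: cvg_cst.
  apply: cvgM; first exact: cvg_cst.
  pose u N := \sum_(1 <= k < N) \prod_(t <- iota 0 k) mes_ratio r q (a + t * A).
  have : u n @[n --> \oo] --> limn u := is_cvg_sum_mes_ratio.
  by rewrite -(@cvg_shiftS _ u).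
have cvgTZ : T N - Z N @[N --> \oo] --> (0 : C).
  apply: (@cvg_complex_dominated _ _ _ (fun N => limn U - U N)).
    by move=> N; rewrite sub0r normrN; exact: TZ.
  by rewrite -[0](subrr (limn U)); apply: cvgB => //; exact: cvg_cst.
have -> : (fun N => \sum_(0 <= n < N) (sigma_mes r A a n)%:R * q ^+ n) =
    (fun N => T N - (T N - Z N)).
  by apply/funext => N; rewrite -/(Z N) opprB addrC subrK.
by rewrite -(subr0 l); exact: cvgB cvgT cvgTZ.
Qed.

End ComplexGenfun.

(** Limits and inverses are total functions here, so the identity comes with the convergence and
    non-vanishing claims that make both of its sides meaningful. *)
Theorem theorem2p9 (R : realType) (A a r : nat) (q : R[i])
    (a_ge1 : (1 <= a)%N) (a_le_A : (a <= A)%N) (r_ge2 : (2 <= r)%N)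
    (q_lt1 : `|q| < 1) :
  let c k := q ^+ (A * 'C(k, 2) + k * a) / qpoch (- q ^+ a) (q ^+ A) k
             * qpoch (- q ^+ ((r - 2) * a)) (q ^+ ((r - 2) * A)) k in
  let s n := (sigma_mes r A a n)%:R * q ^+ n in
  [/\ [/\ cvg_qpoch_inf (- q) q, cvg_qpoch_inf q q & cvg_sum 1 c],
      qpoch_inf q q != 0,
      (forall k, qpoch (- q ^+ a) (q ^+ A) k != 0),
      cvg_sum 0 s
    & infsum 0 s
      = qpoch_inf (- q) q / qpoch_inf q q * (a%:R + A%:R * infsum 1 c)].
Proof.
move=> c s.
have cE : c = fun k => \prod_(t <- iota 0 k) mes_ratio r q (a + t * A).
  by apply/funext => k; rewrite /c mes_coefE.
have cvg_s := cvg_sum_sigma_mes q_lt1 a_ge1 a_le_A r_ge2.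
split.
- split; [exact: is_cvg_qpoch|exact: is_cvg_qpoch|].
  by rewrite /cvg_sum cE; exact: is_cvg_sum_mes_ratio.
- exact: qpoch_inf_neq0.
- move=> k; rewrite prodf_seq_neq0; apply/allP => i _ /=.
  (* Each factor is [1] plus a power of [q] with exponent at least [a], hence nonzero. *)
  rewrite mulNr opprK -exprM -exprD; apply: (@addr1_expr_neq0 _ q) => //.
  by rewrite addn_gt0 a_ge1.
- by apply/cvg_ex; eexists; exact: cvg_s.
- by rewrite cE; apply/cvg_lim => //; exact: cvg_s.
Qed.
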